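(* Let $S=[0,1]^2$ and, for $\varepsilon>0$, let $h_\varepsilon:(0,1)^2\to\mathbb R$, $$h_\varepsilon(z)=z_1\log z_1+(1-z_1)\log(1-z_1)+z_2\log z_2+(1-z_2)\log(1-z_2)+\varepsilon z_1z_2(1-z_1)(1-z_2).$$ Then for all sufficiently small $\varepsilon>0$ the matrix $\mathbf M_\varepsilon(z)=(\nabla_z^2h_\varepsilon(z))^{-1}$ is well-defined for all $z\in(0,1)^2$, extends continuously to $S$ by setting $\mathbf M_\varepsilon(z)=\mathrm{diag}(z_1(1-z_1),z_2(1-z_2))$ for $z\in\partial S$, and has the following four properties: (i) $\mathbf M_\varepsilon:S\to\mathbb R^{2\times2}$ is continuous, and smooth on $\mathrm{int}(S)$; (ii) $\mathbf M_\varepsilon(z)$ is symmetric and positive definite for each $z\in\mathrm{int}(S)$; (iii) $\mathrm D^2\mathbf M_\varepsilon(z)[\zeta,\zeta]$ is negative definite for all $z\in\mathrm{int}(S)$ and all $\zeta\in\mathbb R^2\setminus\{0\}$ (in particular, $\mathrm D^2\mathbf M_\varepsilon(z)[\zeta,\zeta]$ is negative semidefinite for all $z\in\mathrm{int}(S)$ and all $\zeta\in\mathbb R^2$); (iv) $\mathbf M_\varepsilon(z)\nu=0$ if $z\in\partial S$ and $\nu$ is a normal vector to $\partial S$ at $z$.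
   Context: $\mathrm D^2\mathbf M(z)[\zeta,\zeta]=\frac{d^2}{ds^2}\big|_{s=0}\mathbf M(z+s\zeta)$ denotes the second directional derivative of the matrix-valued map $\mathbf M$ with respect to $z$. $\nabla_z^2$ denotes the Hessian with respect to $z$, and $\mathrm{int}(S)=(0,1)^2$ is the interior of $S$. *)

(* Defs.v *)
From HB Require Import structures.
From mathcomp Require Import all_boot all_order all_algebra.
From mathcomp Require Import all_classical all_reals all_analysis.

Set Implicit Arguments.
Unset Strict Implicit.
Unset Printing Implicit Defensive.

Import Order.TTheory GRing.Theory Num.Theory.
Import numFieldNormedType.Exports.

Local Open Scope classical_set_scope.
Local Open Scope ring_scope.

Section Calculus.
Context {R : realType} {n : nat}.
Implicit Types (A U : set 'cV[R]_n.+1) (z nu : 'cV[R]_n.+1).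

Definition partial {W : normedModType R} (i : 'I_n.+1) (f : 'cV[R]_n.+1 -> W) :
  'cV[R]_n.+1 -> W := 'D_(delta_mx i 0) f.

(* C^oo on U (meant for U open): the partial derivatives of all orders exist
   and are continuous at every point of U. *)
Definition smooth_on {W : normedModType R} U (f : 'cV[R]_n.+1 -> W) : Prop :=
  forall (s : seq 'I_n.+1) z, U z ->
    {for z, continuous (foldr partial f s)} /\
    (forall i, derivable (foldr partial f s) z (delta_mx i 0)).

Definition hessian (f : 'cV[R]_n.+1 -> R) z : 'M[R]_n.+1 :=
  \matrix_(i, j) partial i (partial j f) z.

Definition second_directional_derivative {W : normedModType R}
    (f : 'cV[R]_n.+1 -> W) z (zeta : 'cV[R]_n.+1) : W :=
  derive1n 2 (fun s : R => f (z + s *: zeta)) 0.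

Definition boundary A : set 'cV[R]_n.+1 := closure A `\` A°.

Definition normal_cone A z : set 'cV[R]_n.+1 :=
  [set nu | forall w, A w -> \sum_i nu i 0 * (w i 0 - z i 0) <= 0].

(* The linear span of the (convex) normal cone, so that both inner and outer
   normals are included.  For a square it is the normal line at the points of
   the open edges and the whole plane at the corners. *)
Definition normal_vectors A z : set 'cV[R]_n.+1 :=
  [set nu | exists nu1 nu2,
     [/\ normal_cone A z nu1, normal_cone A z nu2 & nu = nu1 - nu2]].

End Calculus.

Section Definiteness.
Context {R : realType} {n : nat}.
Implicit Types A : 'M[R]_n.

Definition quadratic_form A (v : 'cV[R]_n) : R := (v^T *m A *m v) 0 0.

Definition positive_definite A : Prop :=
  A \is symmetricmx /\ forall v, v != 0 -> 0 < quadratic_form A v.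

Definition negative_definite A : Prop :=
  A \is symmetricmx /\ forall v, v != 0 -> quadratic_form A v < 0.

Definition negative_semidefinite A : Prop :=
  A \is symmetricmx /\ forall v, quadratic_form A v <= 0.

End Definiteness.

Section Square.
Context {R : realType}.
Implicit Types (eps : R) (z : 'cV[R]_2).

Definition unit_square : set 'cV[R]_2 := [set z | forall i, 0 <= z i 0 <= 1].

Definition open_unit_square : set 'cV[R]_2 :=
  [set z | forall i, 0 < z i 0 < 1].

(* Only the values on open_unit_square are meaningful: ln vanishes on
   nonpositive numbers. *)
Definition h eps z : R :=
  let z1 := z 0 0 in let z2 := z 1 0 in
  z1 * ln z1 + (1 - z1) * ln (1 - z1) + z2 * ln z2 + (1 - z2) * ln (1 - z2)
  + eps * z1 * z2 * (1 - z1) * (1 - z2).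

(* Only the values on unit_square are meaningful: the inverse Hessian on the
   open square, the diagonal matrix on its boundary. *)
Definition M eps z : 'M[R]_2 :=
  if z \in open_unit_square then invmx (hessian (h eps) z)
  else diag_mx (\row_i (z i 0 * (1 - z i 0))).

Lemma interior_unit_square : unit_square° = open_unit_square.
Proof.
apply/seteqP; split=> z.
- move=> zS i.
  have cvgz : (fun t : R => z + t *: delta_mx i 0) @ 0 --> z.
    rewrite -[X in _ --> X]addr0 -[X in _ + X](scale0r (delta_mx i 0 : 'cV[R]_2)).
    by apply: cvgD; [exact: cvg_cst | apply: cvgZr_tmp; exact: cvg_id].
  have /cvgz/nbhs_ballP[e /= e0 eS] : nbhs z unit_square by exact: zS.
  have e2 : 0 < e / 2 by rewrite divr_gt0.
  have lt_e2 : e / 2 < e by rewrite gtr_pMr // invf_lt1 // ltr1n.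
  have /eS /(_ i) : ball 0 e (e / 2).
    by rewrite /ball /= sub0r normrN gtr0_norm.
  have /eS /(_ i) : ball 0 e (- (e / 2)).
    by rewrite /ball /= sub0r opprK gtr0_norm.
  rewrite !mxE !eqxx !mulr1 => /andP[zge _] /andP[_ zle].
  apply/andP; split.
    by rewrite subr_ge0 in zge; exact: lt_le_trans zge.
  by apply: lt_le_trans zle; rewrite ltrDl.
- move=> zU.
  have nearU (i : 'I_2) : \forall w \near z, 0 < (w : 'cV[R]_2) i 0 < 1.
    have /andP[z0 z1] := zU i.
    have ci : (fun w : 'cV[R]_2 => w i 0) @ z --> z i 0.
      exact: coord_continuous.
    have [w0 w1] := (cvgr_gt _ ci _ z0, cvgr_lt _ ci _ z1).
    by near=> w; apply/andP; split; near: w.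
  have : \forall w \near z, open_unit_square w by apply: filter_forall nearU.
  apply: filterS => w wU i.
  by have /andP[w0 w1] := wU i; rewrite !ltW.
Unshelve. all: by end_near.
Qed.

End Square.

(* Main.v *)
Require Import Defs.
From HB Require Import structures.
From mathcomp Require Import all_boot all_order all_algebra.
From mathcomp Require Import all_classical all_reals all_analysis.
From mathcomp Require Import ring lra.

Set Implicit Arguments.
Unset Strict Implicit.
Unset Printing Implicit Defensive.

Import Order.TTheory GRing.Theory Num.Theory.
Import numFieldNormedType.Exports.

Local Open Scope classical_set_scope.
Local Open Scope ring_scope.

(** With [p = x (1 - x)], [q = y (1 - y)] and
    [D = (1 - 2 eps p q)^2 - eps^2 p q (1 - 4 p) (1 - 4 q)], inverting
    the Hessian of [h eps] by hand gives, on the open square,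
[[
      M eps z = 1/D * [ p (1 - 2 eps p q)                  - eps p q (1 - 2 x) (1 - 2 y) ]
                      [ - eps p q (1 - 2 x) (1 - 2 y)      q (1 - 2 eps p q)             ]
]]
    ([mobility], [mul_hessian_mobility]).  [D] is positive on the whole closed
    square, and on its boundary [p q = 0], so the same formula yields the
    diagonal matrix there ([M_mobility]).  Continuity on the closed square,
    smoothness inside and positive definiteness are read off this formula.
    Smoothness is obtained without any Leibniz formula of higher order: the
    functions built from constants and coordinates by sums, products, inverses
    and logarithms form a class closed under partial derivatives
    ([elementary_derive]), so all their iterated partial derivatives exist and
    are continuous ([smooth_on_coind]).

    For the concavity, the diagonal entry is rewritten as
    [p + eps p^2 q g] with [g = 2 + O(eps)] in C^2 ([diag_coefE],
    [small_jet_diag_coef]).  For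
    [eps = 0] the second derivative of [M] in the direction [(a, b)] is only
    semidefinite, [diag (- 2 a^2, - 2 b^2)]; the term [2 eps p^2 q], which is
    concave in [y], contributes [- 4 eps p^2 b^2], and this restores
    definiteness.  The factor [p^2] degenerates at the boundary, so all error
    terms have to be estimated relative to it.  In terms of
    [|a|], [|b|], [e = p |b|] and [f = q |a|] the second derivative [C] satisfies
[[
      C 0 0 <= - a^2 - eps e^2,   C 1 1 <= - b^2 - eps f^2,
      |C 0 1| <= 17 eps (f |a| + |a| |b| + e |b|)
]]
    ([diag_entry_concave], [offdiag_entry_bound]).  In [v^T C v] the last bound
    is absorbed by the first two, with a factor [sqrt eps] to spare, by the
    inequality between arithmetic and geometric means
    ([quadratic_form_lt0]).  The bound [2500 * eps <= 1] is a convenient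
    threshold for which all these absorptions go through.  In the lemmas [eps]
    is called [u]. *)

(** * Smoothness of elementary functions *)

Section Smoothness.
Context {R : realType} {n : nat}.
Implicit Types (U : set 'cV[R]_n.+1) (z v : 'cV[R]_n.+1).

Lemma open_near_eq {V W : normedModType R} (U : set V) (f g : V -> W) (z : V) :
  open U -> (forall w, U w -> f w = g w) -> U z -> \near z, f z = g z.
Proof.
by move=> oU fg Uz; apply: filterS (open_nbhs_nbhs (conj oU Uz)) => w /fg.
Qed.

(** The iterated partial derivatives of a member of [P] coincide on [U] with
    members of [P], by induction on the order, because a partial derivative on
    an open set depends only on the values there. *)
Lemma smooth_on_coind {W : normedModType R} U
    (P : ('cV[R]_n.+1 -> W) -> Prop) :
  open U ->
  (forall g, P g -> forall z, U z -> {for z, continuous g}) ->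
  (forall g i, P g -> exists2 g', P g' &
    forall z, U z -> is_derive z (delta_mx i 0) g (g' z)) ->
  forall f g, P g -> (forall z, U z -> f z = g z) -> smooth_on U f.
Proof.
move=> oU Pcont Pder f g Pg fg s z Uz.
have [g' Pg' fg'] : exists2 g', P g' &
    forall z, U z -> foldr partial f s z = g' z.
  elim: s => [|i s [g' Pg' IH]] /=; first by exists g.
  have [g'' Pg'' dg'] := Pder g' i Pg'; exists g'' => // w Uw.
  rewrite /partial (@near_eq_derive _ _ _ _ g' w); last exact: (open_near_eq oU IH Uw).
  by have [] := dg' w Uw.
have gfs : \near z, g' z = foldr partial f s z.
  by apply: (open_near_eq oU _ Uz) => w /fg'.
split=> [|i].
  rewrite /prop_for /continuous_at (fg' _ Uz).
  exact: cvg_trans (near_eq_cvg gfs) (Pcont _ Pg' _ Uz).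
have [g'' _ dg'] := Pder g' i Pg'.
have [dz _] := dg' z Uz.
exact: near_eq_derivable gfs dz.
Qed.

(** Reduces directional derivatives to functions of one real variable, where
    the chain rule is available. *)
Lemma is_derive_line {V W : normedModType R} (f : V -> W) (z v : V) (df : W) :
  is_derive z v f df <-> is_derive (0 : R) 1 (fun t : R => f (z + t *: v)) df.
Proof.
have E : (fun h : R => h^-1 *: ((f \o shift z) (h *: v) - f z)) =
  (fun h => h^-1 *: (((fun t : R => f (z + t *: v)) \o shift (0 : R)) (h *: (1 : R))
     - f (z + 0 *: v))).
  apply/funext => h /=.
  by rewrite scale0r !addr0 (addrC z) [h *: 1]mulr1.
by split=> -[d <-]; split; move: d; rewrite /derivable /derive E.
Qed.

Lemma is_derive_comp {V : normedModType R} (F : R -> R) (f : V -> R) (z v : V) a b :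
  is_derive (f z) 1 F a -> is_derive z v f b ->
  is_derive z v (fun w => F (f w)) (a * b).
Proof.
move=> dF /is_derive_line df; apply/is_derive_line.
apply: (@is_derive1_comp R F (fun t => f (z + t *: v))) => //.
by rewrite scale0r addr0.
Qed.

Lemma is_derive_inv {V : normedModType R} (f : V -> R) (z v : V) b : f z != 0 ->
  is_derive z v f b -> is_derive z v (fun w => (f w)^-1) (- (f z) ^- 2 * b).
Proof.
move=> f0 [df <-]; split; first exact: derivableV.
exact: deriveV.
Qed.

Lemma is_derive_coord z v i : is_derive z v (fun w : 'cV[R]_n.+1 => w i 0) (v i 0).
Proof.
apply/is_derive_line.
rewrite (_ : (fun t : R => _) = (fun t : R => z i 0 + t * v i 0)); last first.
  by apply/funext => t; rewrite !mxE.
apply: is_derive_eq; rewrite /=.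
by rewrite scaler0 !add0r mul1r [LHS]mulr1.
Qed.

(** The side conditions are only required on [U], so that [ln] and the inverse
    are allowed where they are differentiable. *)
Inductive elementary U : ('cV[R]_n.+1 -> R) -> Prop :=
| elementary_cst (c : R) : elementary U (fun=> c)
| elementary_coord i : elementary U (fun z => z i 0)
| elementary_add f g : elementary U f -> elementary U g ->
    elementary U (fun z => f z + g z)
| elementary_mul f g : elementary U f -> elementary U g ->
    elementary U (fun z => f z * g z)
| elementary_inv f : elementary U f -> (forall z, U z -> f z != 0) ->
    elementary U (fun z => (f z)^-1)
| elementary_ln f : elementary U f -> (forall z, U z -> 0 < f z) ->
    elementary U (fun z => ln (f z)).

Lemma elementary_sub U f g :
  elementary U f -> elementary U g -> elementary U (fun z => f z - g z).
Proof.
move=> Ef Eg; rewrite (_ : (fun z => _) = (fun z => f z + -1 * g z)).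
  by apply: elementary_add => //; apply: elementary_mul => //; exact: elementary_cst.
by apply/funext => z; rewrite mulN1r.
Qed.

Lemma elementary_continuous U f : elementary U f ->
  forall z, U z -> {for z, continuous f}.
Proof.
elim=> {f} [c|i|f g _ IHf _ IHg|f g _ IHf _ IHg|f _ IHf f0|f _ IHf f0] z Uz.
- exact: cst_continuous.
- exact: coord_continuous.
- exact: (@cvgD _ _ _ _ _ f g _ _ (IHf _ Uz) (IHg _ Uz)).
- exact: (@cvgM _ _ _ _ f g _ _ (IHf _ Uz) (IHg _ Uz)).
- exact: (@cvgV _ _ _ _ f _ (f0 _ Uz) (IHf _ Uz)).
- apply: (@continuous_comp _ _ _ f (@ln R)); first exact: IHf.
  exact: continuous_ln (f0 z Uz).
Qed.

Lemma elementary_derive U f i : elementary U f ->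
  exists2 f', elementary U f' &
    forall z, U z -> is_derive z (delta_mx i 0) f (f' z).
Proof.
elim=> {f} [c|j|f g _ [f' Ef' df] _ [g' Eg' dg]|f g Ef [f' Ef' df] Eg [g' Eg' dg]
  |f Ef [f' Ef' df] f0|f Ef [f' Ef' df] f0].
- by exists (fun=> 0); [exact: elementary_cst|move=> z _; exact: is_derive_cst].
- exists (fun=> (delta_mx i 0 : 'cV_n.+1) j 0); first exact: elementary_cst.
  by move=> z _; exact: is_derive_coord.
- exists (fun z => f' z + g' z); first exact: elementary_add.
  by move=> z Uz; apply: is_deriveD; [exact: df|exact: dg].
- exists (fun z => f z * g' z + g z * f' z).
    by apply: elementary_add; apply: elementary_mul.
  by move=> z Uz; apply: is_deriveM; [exact: df|exact: dg].
- exists (fun z => -1 * ((f z)^-1 * (f z)^-1) * f' z).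
    apply: elementary_mul => //; apply: elementary_mul; first exact: elementary_cst.
    by apply: elementary_mul; apply: elementary_inv.
  move=> z Uz; have := is_derive_inv (f0 _ Uz) (df _ Uz).
  by rewrite mulN1r -expr2 exprVn.
- exists (fun z => (f z)^-1 * f' z).
    apply: elementary_mul => //; apply: elementary_inv => // z /f0.
    by move/lt0r_neq0.
  move=> z Uz; apply: is_derive_comp; last exact: df.
  exact: is_derive1_ln (f0 _ Uz).
Qed.

Lemma elementary_smooth U f g : open U -> elementary U g ->
  (forall z, U z -> f z = g z) -> smooth_on U f.
Proof.
move=> oU; apply: (smooth_on_coind (W := R) oU (P := elementary U)).
  exact: elementary_continuous.
move=> {}g i; exact: elementary_derive.
Qed.

Lemma mx_continuous {T : topologicalType} {m p} (F : T -> 'M[R]_(m.+1, p.+1)) (z : T) :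
  (forall i j, {for z, continuous (fun w => F w i j)}) -> {for z, continuous F}.
Proof.
move=> cF; apply/cvgrPdist_le => /= e e0; near=> w.
rewrite /Num.Def.normr/= mx_normrE (bigmax_le _ (ltW e0))//= => -[i j] _.
rewrite !mxE /=; move: i j; near: w; apply: filter_forall => i.
apply: filter_forall => j; exact: ((cvgrPdist_le _ _).1 (cF i j)).
Unshelve. all: by end_near. Qed.

Lemma is_derive_mx {V : normedModType R} {m p} (F : V -> 'M[R]_(m.+1, p.+1)) (z v : V)
    (D : 'M[R]_(m.+1, p.+1)) :
  (forall i j, is_derive z v (fun w => F w i j) (D i j)) -> is_derive z v F D.
Proof.
move=> dF.
have Fd : derivable F z v.
  by apply/derivable_mxP => i j; have [] := dF i j.
split=> //; rewrite derive_mx //; apply/matrixP => i j; rewrite mxE.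
by have [] := dF i j.
Qed.

(** Both continuity and differentiability of matrix-valued maps are entrywise,
    so matrices of elementary functions are again closed under partial
    derivatives. *)
Lemma elementary_mx_smooth {m p} U (F G : 'cV[R]_n.+1 -> 'M[R]_(m.+1, p.+1)) :
  open U -> (forall i j, elementary U (fun z => G z i j)) ->
  (forall z, U z -> F z = G z) -> smooth_on U F.
Proof.
move=> oU; apply: (smooth_on_coind (W := 'M[R]_(m.+1, p.+1)) oU
  (P := fun G => forall i j, elementary U (fun z => G z i j))).
  move=> {}G EG z Uz; apply: mx_continuous => i j.
  exact: (elementary_continuous (EG i j) Uz).
move=> {}G l EG.
have H (ij : 'I_m.+1 * 'I_p.+1) : exists f', elementary U f' /\
    forall z, U z -> is_derive z (delta_mx l 0) (fun w => G w ij.1 ij.2) (f' z).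
  by have [f' ? ?] := elementary_derive l (EG ij.1 ij.2); exists f'.
have [D HD] := choice H.
exists (fun z => \matrix_(i, j) D (i, j) z).
  move=> i j; rewrite (_ : (fun z => _) = D (i, j)); last first.
    by apply/funext => z; rewrite mxE.
  by have [] := HD (i, j).
move=> z Uz; apply: is_derive_mx => i j; rewrite mxE.
by have [_ /(_ z Uz)] := HD (i, j).
Qed.

End Smoothness.

(** * Second-order jets of functions of one variable *)

Section Jets.
Context {R : realType}.

(** First-order differentiability is asked for near 0, so that the second
    derivative at 0 makes sense as the derivative of [derive1 f]. *)
Definition jet2 {W : normedModType R} (f : R -> W) (b c : W) : Prop :=
  [/\ \forall s \near (0 : R), derivable f (s : R) 1, derive1 f 0 = b &
      is_derive (0 : R) 1 (derive1 f) c].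

Lemma jet2_derive1n {W : normedModType R} (f : R -> W) (b c : W) :
  jet2 f b c -> derive1n 2 f 0 = c.
Proof. by move=> [_ _ [_ <-]]; rewrite derive1nS derive1n1 derive1E. Qed.

(** It suffices to know the derivative near 0 in some form, which need not be
    syntactically [derive1 f]. *)
Lemma jet2_ex {W : normedModType R} (f f1 : R -> W) (c : W) :
  (\forall s \near (0 : R), is_derive (s : R) 1 f (f1 s)) ->
  is_derive (0 : R) 1 f1 c -> jet2 f (f1 0) c.
Proof.
move=> df df1.
have E : \forall s \near (0 : R), f1 s = derive1 f s.
  by apply: filterS df => s [_ <-]; rewrite derive1E.
split; first by apply: filterS df => s [].
- by rewrite (nbhs_singleton E).
- exact: near_eq_is_derive E df1.
Qed.

Lemma jet2_near {W : normedModType R} (f : R -> W) (b c : W) : jet2 f b c ->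
  \forall s \near (0 : R), is_derive (s : R) 1 f (derive1 f s).
Proof.
by move=> [df _ _]; apply: filterS df => s df; rewrite derive1E; exact: derivableP.
Qed.

Lemma jet2_continuous (f : R -> R) (b c : R) : jet2 f b c -> {for 0, continuous f}.
Proof.
by move=> [/nbhs_singleton/derivable1_diffP/differentiable_continuous].
Qed.

Lemma jet2_near_eq {W : normedModType R} (f g : R -> W) (b c : W) :
  (\forall s \near (0 : R), f s = g s) -> jet2 f b c -> jet2 g b c.
Proof.
move=> fg jf; have [_ <- df1] := jf.
apply: (jet2_ex (f1 := derive1 f) _ df1).
have := jet2_near jf; have := near_join fg; apply: filterS2 => s fg' df.
exact: near_eq_is_derive fg' df.
Qed.

Lemma jet2_ext (f g : R -> R) (b c b' c' : R) :
  jet2 f b c -> (forall s, f s = g s) -> b = b' -> c = c' -> jet2 g b' c'.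
Proof. by move=> jf /funext <- <- <-. Qed.

Lemma jet2_cst (k : R) : jet2 (fun=> k) (0 : R) (0 : R).
Proof.
apply: (jet2_ex (f1 := fun=> 0)).
by near=> s; exact: (is_derive_cst k s 1).
Unshelve. all: by end_near. Qed.

Lemma jet2_line (x v : R) : jet2 (fun s => x + s * v) v (0 : R).
Proof.
apply: (jet2_ex (f1 := fun=> v)).
near=> s; apply: is_derive_eq.
by rewrite scaler0 !add0r mul1r [LHS]mulr1.
Unshelve. all: by end_near. Qed.

Lemma jet2D (f g : R -> R) (b c b' c' : R) : jet2 f b c -> jet2 g b' c' ->
  jet2 (fun s => f s + g s) (b + b') (c + c').
Proof.
move=> jf jg; have [_ <- df] := jf; have [_ <- dg] := jg.
apply: (jet2_ex (f1 := fun s => derive1 f s + derive1 g s)).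
have := jet2_near jg; have := jet2_near jf; apply: filterS2 => s fs gs.
exact: is_deriveD.
Qed.

Lemma jet2M (f g : R -> R) (b c b' c' : R) : jet2 f b c -> jet2 g b' c' ->
  jet2 (fun s => f s * g s) (f 0 * b' + g 0 * b)
    (f 0 * c' + 2 * b * b' + g 0 * c).
Proof.
move=> jf jg; have [_ <- df] := jf; have [_ <- dg] := jg.
apply: (jet2_ex (f1 := fun s => f s * derive1 g s + g s * derive1 f s)).
  have := jet2_near jg; have := jet2_near jf; apply: filterS2 => s fs gs.
  exact: is_deriveM.
have f0 := nbhs_singleton (jet2_near jf); have g0 := nbhs_singleton (jet2_near jg).
apply: (@is_derive_eq _ _ _ _ _ _ _ _
  (is_deriveD (is_deriveM f0 dg) (is_deriveM g0 df))).
by rewrite /GRing.scale /=; ring.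
Qed.

Lemma jet2V (f : R -> R) (b c : R) : f 0 != 0 -> jet2 f b c ->
  jet2 (fun s => (f s)^-1) (- (f 0) ^- 2 * b)
    (2 * b ^+ 2 * (f 0) ^- 3 - (f 0) ^- 2 * c).
Proof.
move=> f0 jf; have [_ <- df] := jf.
have f0d := nbhs_singleton (jet2_near jf).
have fn0 : \forall s \near (0 : R), f s != 0.
  exact: cvgr_neq0 (jet2_continuous jf) f0.
apply: (jet2_ex (f1 := fun s => - (f s) ^- 2 * derive1 f s)).
  have := fn0; have := jet2_near jf; apply: filterS2 => s fs fs0.
  exact: is_derive_inv.
rewrite (_ : (fun s => _) = (fun s => (-1 * ((f s)^-1 * (f s)^-1)) * derive1 f s)); last first.
  by apply/funext => s; rewrite mulN1r -expr2 exprVn.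
have fV := is_derive_inv f0 f0d.
apply: (@is_derive_eq _ _ _ _ _ _ _ _
  (is_deriveM (is_deriveM (is_derive_cst (-1 : R) (0 : R) 1) (is_deriveM fV fV)) df)).
by rewrite /GRing.scale /cst /= !fctE /=; field.
Qed.

Lemma jet2_mx {m p} (F : R -> 'M[R]_(m.+1, p.+1)) (B C : 'M[R]_(m.+1, p.+1)) :
  (forall i j, jet2 (fun s => F s i j) (B i j) (C i j)) -> jet2 F B C.
Proof.
move=> jF.
pose F1 s : 'M[R]_(m.+1, p.+1) := \matrix_(i, j) derive1 (fun s => F s i j) s.
have -> : B = F1 0.
  by apply/matrixP => i j; rewrite mxE; have [_ ->] := jF i j.
apply: jet2_ex.
  near=> s; apply: is_derive_mx; near: s.
  apply: filter_forall => i; apply: filter_forall => j.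
  by apply: filterS (jet2_near (jF i j)) => s; rewrite mxE.
apply: is_derive_mx => i j.
rewrite (_ : (fun s => _) = derive1 (fun s => F s i j)); first by have [] := jF i j.
by apply/funext => s; rewrite mxE.
Unshelve. all: by end_near. Qed.

End Jets.

(** * Quantitative bounds on jets *)

Section SmallJets.
Context {R : realType}.
Implicit Types (f g : R -> R) (L C : R).

(** [f] is meant to be the restriction of a function on the plane to a line that
    is run through at speed [L], whence the powers of [L].  The factor 2 in front of
    [L ^+ 2] makes the bound of the second derivative match a Taylor
    coefficient, which keeps the constant in the bound of a product small. *)
Definition small_jet L C f : Prop := exists b c : R,
  [/\ jet2 f b c, `|f 0| <= C, `|b| <= C * L & `|c| <= 2 * C * L ^+ 2].

Lemma small_jet_le L C C' f : 0 <= L -> C <= C' ->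
  small_jet L C f -> small_jet L C' f.
Proof.
move=> L0 CC' [b [c [jf fC bC cC]]]; exists b, c; split => //.
- exact: le_trans CC'.
- by apply: le_trans bC _; rewrite ler_wpM2r.
- by apply: le_trans cC _; rewrite ler_wpM2r ?exprn_ge0 // ler_pM2l.
Qed.

Lemma small_jet_ext L C f g : (forall s, f s = g s) ->
  small_jet L C f -> small_jet L C g.
Proof. by move=> /funext ->. Qed.

Lemma small_jet_cst L C (k : R) : 0 <= L -> `|k| <= C ->
  small_jet L C (fun=> k).
Proof.
move=> L0 kC; have C0 : 0 <= C by exact: le_trans kC.
exists 0, 0; split; [exact: jet2_cst|by []|rewrite normr0 mulr_ge0//|].
by rewrite normr0 !mulr_ge0// exprn_ge0.
Qed.

Lemma small_jetD L C C' f g : small_jet L C f -> small_jet L C' g ->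
  small_jet L (C + C') (fun s => f s + g s).
Proof.
move=> [b [c [jf fC bC cC]]] [b' [c' [jg gC bC' cC']]].
exists (b + b'), (c + c'); split; first exact: jet2D.
- by apply: le_trans (ler_normD _ _) _; lra.
- by apply: le_trans (ler_normD _ _) _; lra.
- by apply: le_trans (ler_normD _ _) _; lra.
Qed.

(** Leibniz: the second derivative of the product is at most
    [(2 + 2 + 2) C C' L^2], hence the constant 3. *)
Lemma small_jetM L C C' f g : 0 <= L -> small_jet L C f -> small_jet L C' g ->
  small_jet L (3 * C * C') (fun s => f s * g s).
Proof.
move=> L0 [b [c [jf fC bC cC]]] [b' [c' [jg gC bC' cC']]].
have C0 : 0 <= C by exact: le_trans fC.
have C0' : 0 <= C' by exact: le_trans gC.
have CC0 : 0 <= C * C' by rewrite mulr_ge0.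
have CL : 0 <= C * C' * L by rewrite mulr_ge0.
exists (f 0 * b' + g 0 * b), (f 0 * c' + 2 * b * b' + g 0 * c).
have fb' : `|f 0 * b'| <= C * (C' * L) by rewrite normrM ler_pM.
have gb : `|g 0 * b| <= C' * (C * L) by rewrite normrM ler_pM.
have fc' : `|f 0 * c'| <= C * (2 * C' * L ^+ 2) by rewrite normrM ler_pM.
have gc : `|g 0 * c| <= C' * (2 * C * L ^+ 2) by rewrite normrM ler_pM.
have bb : `|2 * b * b'| <= 2 * (C * L) * (C' * L).
  by rewrite -2!mulrA normrM ger0_norm // ler_pM2l // normrM ler_pM.
split; first exact: jet2M.
- apply: (@le_trans _ _ (C * C')); first by rewrite normrM ler_pM.
  by lra.
- by apply: le_trans (ler_normD _ _) _; lra.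
- apply: le_trans (ler_normD _ _) _.
  have := ler_normD (f 0 * c') (2 * b * b').
  by lra.
Qed.

Lemma small_jetZ L C (k : R) f : 0 <= k -> small_jet L C f ->
  small_jet L (k * C) (fun s => k * f s).
Proof.
move=> k0 [b [c [jf fC bC cC]]]; exists (k * b), (k * c); split.
- apply: jet2_ext (jet2M (jet2_cst k) jf) _ _ _.
  - by [].
  - by ring.
  - by ring.
- by rewrite normrM ger0_norm // ler_wpM2l.
- by rewrite normrM ger0_norm // -mulrA ler_wpM2l.
- rewrite normrM ger0_norm // (_ : 2 * (k * C) * _ = k * (2 * C * L ^+ 2)).
    by rewrite ler_wpM2l.
  by ring.
Qed.

Lemma small_jetN L C f : small_jet L C f -> small_jet L C (fun s => - f s).
Proof.
move=> [b [c [jf fC bC cC]]]; exists (- b), (- c); rewrite !normrN; split=> //.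
by apply: jet2_ext (jet2M (jet2_cst (-1)) jf) _ _ _;
    [move=> s; rewrite mulN1r|ring|ring].
Qed.

(** As [1 - f 0 >= 1/2], the inverse [k] is at most 2; the jet of [k - 1] is
    [(k f, k^2 f', k^2 f'' + 2 k^3 f'^2)].  The quadratic term is absorbed
    using [C <= 1/2]. *)
Lemma small_jet_inv_onem L C f : 0 <= L -> C <= 1 / 2 -> small_jet L C f ->
  small_jet L (8 * C) (fun s => (1 - f s)^-1 - 1).
Proof.
move=> L0 C2 [b [c [jf fC bC cC]]].
have C0 : 0 <= C by exact: le_trans fC.
have fge : 1 / 2 <= 1 - f 0 by move: fC; rewrite ler_norml => /andP[]; lra.
have f0 : 1 - f 0 != 0 by apply: lt0r_neq0; lra.
have j1 : jet2 (fun s => 1 - f s) (- b) (- c).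
  by apply: jet2_ext (jet2D (jet2_cst 1) (jet2M (jet2_cst (-1)) jf)) _ _ _;
    [move=> s; rewrite mulN1r|ring|ring].
have j2 := jet2D (jet2V f0 j1) (jet2_cst (-1)).
set k := (1 - f 0)^-1 in j2 *.
have kf : k * (1 - f 0) = 1 by rewrite mulVf.
have k0 : 0 <= k by rewrite invr_ge0; lra.
have k2 : k <= 2 by rewrite /k -(invrK 2) lef_pV2 ?posrE; lra.
eexists; eexists; split; first exact: j2.
- rewrite /= -/k (_ : k - 1 = k * f 0); last by rewrite -kf; ring.
  rewrite normrM (ger0_norm k0).
  by apply: le_trans (ler_pM k0 (normr_ge0 _) k2 fC) _; lra.
- rewrite addr0 -exprVn -/k mulrNN normrM (ger0_norm (exprn_ge0 _ k0)).
  have k4 : k ^+ 2 <= 2 ^+ 2 by rewrite lerXn2r ?nnegrE.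
  apply: le_trans (ler_pM (exprn_ge0 _ k0) (normr_ge0 _) k4 bC) _.
  by have := mulr_ge0 C0 L0; lra.
- rewrite addr0 -!exprVn -/k sqrrN mulrN opprK.
  have k4 : k ^+ 2 <= 2 ^+ 2 by rewrite lerXn2r ?nnegrE.
  have k8 : k ^+ 3 <= 2 ^+ 3 by rewrite lerXn2r ?nnegrE.
  have bb : `|b ^+ 2| <= (C * L) ^+ 2.
    by rewrite normrX lerXn2r ?nnegrE // mulr_ge0.
  have bk : `|2 * b ^+ 2 * k ^+ 3| <= 2 * (C * L) ^+ 2 * 2 ^+ 3.
    rewrite normrM (ger0_norm (exprn_ge0 3 k0)) normrM (ger0_norm (ler0n _ 2)).
    by apply: ler_pM; rewrite ?mulr_ge0 ?exprn_ge0 // ler_pM2l.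
  have ck : `|k ^+ 2 * c| <= 2 ^+ 2 * (2 * C * L ^+ 2).
    by rewrite normrM (ger0_norm (exprn_ge0 _ k0)) ler_pM // exprn_ge0.
  apply: le_trans (ler_normD _ _) _.
  apply: le_trans (lerD bk ck) _.
  have CL : 0 <= C * L ^+ 2 by rewrite mulr_ge0 // exprn_ge0.
  have CCL : C * (C * L ^+ 2) <= 1 / 2 * (C * L ^+ 2) by rewrite ler_wpM2r.
  by rewrite exprMn; lra.
Qed.

End SmallJets.

(** * Second derivatives of the entries along a line *)

Section Estimates.
Context {R : realType}.

(** The reciprocal of the second derivative of [t ln t + (1 - t) ln (1 - t)]. *)
Definition logistic (t : R) : R := t * (1 - t).

Lemma ler_normM (x y X Y : R) : `|x| <= X -> `|y| <= Y -> `|x * y| <= X * Y.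
Proof. by move=> xX yY; rewrite normrM ler_pM. Qed.

(** The square of the derivative of [logistic] is a polynomial in [logistic];
    this is what turns [det (hessian (h eps) z)] into a function of [p] and [q]. *)
Lemma sqr_onem2 (t : R) : (1 - 2 * t) ^+ 2 = 1 - 4 * logistic t.
Proof. by rewrite /logistic; ring. Qed.

Lemma logistic_le (t : R) : logistic t <= 1 / 4.
Proof. by have := sqr_ge0 (1 - 2 * t); rewrite sqr_onem2; lra. Qed.

Lemma logistic_gt0 (t : R) : 0 < t < 1 -> 0 < logistic t.
Proof. by move=> /andP[t0 t1]; rewrite mulr_gt0 // subr_gt0. Qed.

Lemma logistic_ge0 (t : R) : 0 <= t <= 1 -> 0 <= logistic t.
Proof. by move=> /andP[t0 t1]; rewrite mulr_ge0 // subr_ge0. Qed.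

Lemma norm_onem2_le1 (t : R) : 0 <= t <= 1 -> `|1 - 2 * t| <= 1.
Proof. by move=> /andP[t0 t1]; rewrite ler_norml; apply/andP; split; lra. Qed.

(** [p q] times the determinant of the Hessian of [h u]. *)
Definition denom (u p q : R) : R :=
  (1 - 2 * u * (p * q)) ^+ 2 - u ^+ 2 * (p * q) * ((1 - 4 * p) * (1 - 4 * q)).

(** Symmetric in [p] and [q] and equal to [2 + O(u)]; see [diag_coefE]. *)
Definition diag_coef (u p q : R) : R :=
  (2 - 4 * u * (p * q) + u * ((1 - 4 * p) * (1 - 4 * q))) * (denom u p q)^-1.

(** Isolates the first correction [2 u p^2 q] to the diagonal entry [p], with a
    factor [p ^+ 2] in front of the whole remainder.  This factor makes
    the later estimates uniform up to the boundary. *)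
Lemma diag_coefE (u p q : R) : denom u p q != 0 ->
  p * (1 - 2 * u * (p * q)) / denom u p q = p + u * (p * p * q * diag_coef u p q).
Proof. by rewrite /diag_coef /denom => D0; field. Qed.

(** [p q <= 1/16] makes the first square at least [(15/16)^2], whereas the
    subtracted term is at most [1/64]. *)
Lemma denom_gt0 (u p q : R) : 0 <= u <= 1 / 2 -> 0 <= p <= 1 / 4 ->
  0 <= q <= 1 / 4 -> 0 < denom u p q.
Proof.
move=> /andP[u0 u1] /andP[p0 p1] /andP[q0 q1].
have pq0 : 0 <= p * q by rewrite mulr_ge0.
have pq1 : p * q <= 1 / 16 by apply: (le_trans (ler_pM p0 q0 p1 q1)); lra.
have s0 : 0 <= (1 - 4 * p) * (1 - 4 * q) by rewrite mulr_ge0; lra.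
have s1 : (1 - 4 * p) * (1 - 4 * q) <= 1 * 1 by rewrite ler_pM; lra.
have uu : u * (p * q) <= 1 / 2 * (1 / 16) by rewrite ler_pM.
have u2 : u ^+ 2 * (p * q) <= (1 / 2) ^+ 2 * (1 / 16).
  by rewrite ler_pM ?exprn_ge0 // lerXn2r ?nnegrE //; lra.
have := ler_pM (mulr_ge0 (exprn_ge0 2 u0) pq0) s0 u2 s1.
have : (15 / 16) ^+ 2 <= (1 - 2 * u * (p * q)) ^+ 2.
  by rewrite lerXn2r ?nnegrE; lra.
by rewrite /denom; lra.
Qed.

Section Line.
Context (x y a b : R) (x01 : 0 <= x <= 1) (y01 : 0 <= y <= 1).
Let P s := logistic (x + s * a).
Let Q s := logistic (y + s * b).
Let L := `|a| + `|b|.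
Let p := logistic x.
Let q := logistic y.

Lemma jet2_logistic (x' a' : R) : jet2 (fun s => logistic (x' + s * a'))
  ((1 - 2 * x') * a') (- 2 * a' ^+ 2).
Proof.
have j1 := jet2_line x' a'.
have j2 := jet2D (jet2_cst 1) (jet2M (jet2_cst (-1)) j1).
apply: jet2_ext (jet2M j1 j2) _ _ _.
- by move=> s; rewrite /logistic; ring.
- by ring.
- by ring.
Qed.

Let L0 : 0 <= L. Proof. by rewrite addr_ge0. Qed.
Let p0 : 0 <= p. Proof. exact: logistic_ge0. Qed.
Let q0 : 0 <= q. Proof. exact: logistic_ge0. Qed.
Let p1 : p <= 1 / 4. Proof. exact: logistic_le. Qed.
Let q1 : q <= 1 / 4. Proof. exact: logistic_le. Qed.
Let P0E : P 0 = p. Proof. by rewrite /P mul0r addr0. Qed.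
Let Q0E : Q 0 = q. Proof. by rewrite /Q mul0r addr0. Qed.
Let np : `|p| <= 1 / 4. Proof. by rewrite ger0_norm. Qed.
Let nq : `|q| <= 1 / 4. Proof. by rewrite ger0_norm. Qed.
Let nsp : `|1 - 4 * p| <= 1.
Proof. by rewrite ler_norml; apply/andP; split; move: p0 p1; lra. Qed.
Let nsq : `|1 - 4 * q| <= 1.
Proof. by rewrite ler_norml; apply/andP; split; move: q0 q1; lra. Qed.
Let ndp := norm_onem2_le1 x01.
Let ndq := norm_onem2_le1 y01.
Let n2 : `|2 : R| <= 2. Proof. by rewrite ger0_norm. Qed.
Let n4 : `|- 4 : R| <= 4. Proof. by rewrite normrN ger0_norm. Qed.
Let ab0 : 0 <= `|a| * `|b|. Proof. by rewrite mulr_ge0. Qed.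

Lemma small_jet_logisticM : small_jet L (1 / 2) (fun s => P s * Q s).
Proof.
have j := jet2M (jet2_logistic x a) (jet2_logistic y b).
eexists; eexists; split; first exact: j.
- by apply: le_trans (ler_normM (Y := 1 / 4) _ _) _;
    [rewrite P0E; exact: np|rewrite Q0E; exact: nq|lra].
- rewrite -/(P 0) -/(Q 0) P0E Q0E; apply: le_trans (ler_normD _ _) _.
  have := ler_normM np (ler_normM ndq (lexx `|b|)).
  have := ler_normM nq (ler_normM ndp (lexx `|a|)).
  by rewrite /L; have := normr_ge0 a; have := normr_ge0 b; lra.
- rewrite -/(P 0) -/(Q 0) P0E Q0E; apply: le_trans (ler_normD _ _) _.
  have h1 : `|p * (-2 * b ^+ 2)| <= 1 / 4 * (2 * `|b| ^+ 2).
    by apply: ler_normM np _; rewrite mulNr normrN normrM normrX ger0_norm.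
  have h2 : `|q * (-2 * a ^+ 2)| <= 1 / 4 * (2 * `|a| ^+ 2).
    by apply: ler_normM nq _; rewrite mulNr normrN normrM normrX ger0_norm.
  have h3 : `|2 * ((1 - 2 * x) * a) * ((1 - 2 * y) * b)|
     <= 2 * (1 * `|a|) * (1 * `|b|).
    exact: ler_normM (ler_normM n2 (ler_normM ndp (lexx _))) (ler_normM ndq (lexx _)).
  have := ler_normD (p * (-2 * b ^+ 2)) (2 * ((1 - 2 * x) * a) * ((1 - 2 * y) * b)).
  have := sqr_ge0 `|a|; have := sqr_ge0 `|b|; move: ab0; rewrite /L; lra.
Qed.

Lemma small_jet_discrM :
  small_jet L 8 (fun s => (1 - 4 * P s) * (1 - 4 * Q s)).
Proof.
have jl x' a' : jet2 (fun s => 1 - 4 * logistic (x' + s * a'))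
    (- 4 * ((1 - 2 * x') * a')) (8 * a' ^+ 2).
  apply: jet2_ext (jet2D (jet2_cst 1) (jet2M (jet2_cst (-4)) (jet2_logistic x' a'))) _ _ _.
  - by move=> s; ring.
  - by ring.
  - by ring.
have j := jet2M (jl x a) (jl y b).
eexists; eexists; split; first exact: j.
- rewrite -/(P 0) -/(Q 0) P0E Q0E.
  by apply: le_trans (ler_normM nsp nsq) _; lra.
- rewrite -/(P 0) -/(Q 0) P0E Q0E; apply: le_trans (ler_normD _ _) _.
  have h1 : `|(1 - 4 * p) * (- 4 * ((1 - 2 * y) * b))| <= 1 * (4 * (1 * `|b|)).
    exact: ler_normM nsp (ler_normM n4 (ler_normM ndq (lexx _))).
  have h2 : `|(1 - 4 * q) * (- 4 * ((1 - 2 * x) * a))| <= 1 * (4 * (1 * `|a|)).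
    exact: ler_normM nsq (ler_normM n4 (ler_normM ndp (lexx _))).
  by rewrite /L; have := normr_ge0 a; have := normr_ge0 b; lra.
- rewrite -/(P 0) -/(Q 0) P0E Q0E; apply: le_trans (ler_normD _ _) _.
  have h1 : `|(1 - 4 * p) * (8 * b ^+ 2)| <= 1 * (8 * `|b| ^+ 2).
    by apply: ler_normM nsp _; rewrite normrM normrX ger0_norm.
  have h2 : `|(1 - 4 * q) * (8 * a ^+ 2)| <= 1 * (8 * `|a| ^+ 2).
    by apply: ler_normM nsq _; rewrite normrM normrX ger0_norm.
  have h3 : `|2 * (- 4 * ((1 - 2 * x) * a)) * (- 4 * ((1 - 2 * y) * b))|
     <= 2 * (4 * (1 * `|a|)) * (4 * (1 * `|b|)).
    exact: ler_normM (ler_normM n2 (ler_normM n4 (ler_normM ndp (lexx _))))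
      (ler_normM n4 (ler_normM ndq (lexx _))).
  have := ler_normD ((1 - 4 * p) * (8 * b ^+ 2))
    (2 * (- 4 * ((1 - 2 * x) * a)) * (- 4 * ((1 - 2 * y) * b))).
  have := sqr_ge0 `|a|; have := sqr_ge0 `|b|; move: ab0; rewrite /L; lra.
Qed.

Context (u : R) (u0 : 0 <= u) (u_small : 2500 * u <= 1).

(** [denom = 1 - u r] with [r = 4 t - 4 u t^2 + u t S], where [t = p q] and
    [S = (1 - 4 p) (1 - 4 q)]; the jet of [r] is bounded by 3. *)
Lemma small_jet_denomV :
  small_jet L (24 * u) (fun s => (denom u (P s) (Q s))^-1 - 1).
Proof.
have jt := small_jet_logisticM; have jS := small_jet_discrM.
have j1 := small_jetZ (ler0n _ 4) jt.
have j2 := small_jetN (small_jetZ (mulr_ge0 (ler0n R 4) u0) (small_jetM L0 jt jt)).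
have j3 := small_jetZ u0 (small_jetM L0 jt jS).
have je := small_jetZ u0 (small_jetD (small_jetD j1 j2) j3).
have je3 : small_jet L (u * 3) (fun s => 1 - denom u (P s) (Q s)).
  have C3 : u * (4 * (1 / 2) + 4 * u * (3 * (1 / 2) * (1 / 2)) +
      u * (3 * (1 / 2) * 8)) <= u * 3.
    by apply: ler_wpM2l => //; move: u_small; lra.
  apply: small_jet_ext (small_jet_le L0 C3 je) => s.
  by rewrite /denom; ring.
have u3 : u * 3 <= 1 / 2 by move: u_small; lra.
have C24 : 8 * (u * 3) <= 24 * u by lra.
apply: small_jet_ext (small_jet_le L0 C24 (small_jet_inv_onem L0 u3 je3)) => s.
by rewrite subKr.
Qed.

Lemma small_jet_denomV2 :
  small_jet L 2 (fun s => (denom u (P s) (Q s))^-1).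
Proof.
have n1 : `|1 : R| <= 1 by rewrite normr1.
have j := small_jetD small_jet_denomV (small_jet_cst L0 n1).
have C2 : 24 * u + 1 <= 2 by move: u_small; lra.
by apply: small_jet_ext (small_jet_le L0 C2 j) => s; rewrite subrK.
Qed.

(** [diag_coef - 2 = 2 (1/denom - 1) + u (S - 4 t) / denom] with the notation
    [t = p q] and [S = (1 - 4 p) (1 - 4 q)]. *)
Lemma small_jet_diag_coef :
  small_jet L (108 * u) (fun s => diag_coef u (P s) (Q s) - 2).
Proof.
have j1 := small_jetZ (ler0n R 2) small_jet_denomV.
have j2 := small_jetD small_jet_discrM
  (small_jetN (small_jetZ (ler0n R 4) small_jet_logisticM)).
have j3 := small_jetZ u0 (small_jetM L0 j2 small_jet_denomV2).
have C : 2 * (24 * u) + u * (3 * (8 + 4 * (1 / 2)) * 2) <= 108 * u by lra.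
apply: small_jet_ext (small_jet_le L0 C (small_jetD j1 j3)) => s.
by rewrite /diag_coef; ring.
Qed.

(** Write [A = |a|] and [e = p |b|].  The jet of [p] contributes [- 2 a^2].  In the
    second derivative of [p^2 q g], the part [- 2 p^2 b^2 g] is about
    [- 4 e^2]; every other term carries enough factors [p] to be bounded by a
    multiple of [A^2], of [A e], or by a small multiple of [e^2], even though
    the jet of [g] is only bounded in terms of [|a| + |b|]. *)
Lemma diag_entry_concave : exists c d : R,
  jet2 (fun s => P s + u * (P s * P s * Q s * diag_coef u (P s) (Q s))) c d /\
  d <= - a ^+ 2 - u * (p * `|b|) ^+ 2.
Proof.
have [g1 [g2 [jg' g0B g1B g2B]]] := small_jet_diag_coef.
have jg : jet2 (fun s => diag_coef u (P s) (Q s)) g1 g2.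
  apply: jet2_ext (jet2D jg' (jet2_cst 2)) _ _ _; rewrite ?addr0 //.
  by move=> s; rewrite subrK.
have jP := jet2_logistic x a; have jQ := jet2_logistic y b.
have j := jet2D jP (jet2M (jet2_cst u) (jet2M (jet2M (jet2M jP jP) jQ) jg)).
eexists; eexists; split; first exact: j.
rewrite /= -/(P 0) -/(Q 0) P0E Q0E.
rewrite P0E Q0E in g0B.
set g0 := diag_coef u p q in g0B *.
have {}g0B : `|g0 - 2| <= 1 / 10.
  by apply: le_trans g0B _; move: u_small; lra.
have {}g1B : `|g1| <= L / 10.
  apply: le_trans g1B _; rewrite mulrC ler_wpM2l //; move: u_small; lra.
have {}g2B : `|g2| <= L ^+ 2 / 10.
  apply: le_trans g2B _; rewrite mulrC ler_wpM2l ?sqr_ge0 //; move: u_small; lra.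
pose dp := 1 - 2 * x; pose dq := 1 - 2 * y; rewrite -/dp -/dq.
have ndp1 : `|dp| <= 1 := ndp; have ndq1 : `|dq| <= 1 := ndq.
have dp2 : dp ^+ 2 = 1 - 4 * p by rewrite sqr_onem2.
have A0 := normr_ge0 a; have B0 := normr_ge0 b.
set A := `|a| in A0 *; set B := `|b| in B0 *; set e := p * B.
have e0 : 0 <= e by rewrite mulr_ge0.
have pL : p * L <= A / 4 + e.
  by have := ler_wpM2r A0 p1; rewrite /e mulrDr -/A -/B; lra.
have g0n : `|g0| <= 21 / 10.
  rewrite -(subrK 2 g0); apply: le_trans (ler_normD _ _) _.
  by rewrite (ger0_norm (ler0n R 2)); lra.
have g0l : 19 / 10 <= g0 by move: g0B; rewrite ler_norml => /andP[]; lra.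
have t1 : `|(2 - 12 * p) * q * a ^+ 2 * g0| <= 2 * (1 / 4) * A ^+ 2 * (21 / 10).
  apply: ler_normM g0n; apply: ler_normM; last by rewrite normrX.
  apply: ler_normM nq; rewrite ler_norml; apply/andP; split; move: p0 p1; lra.
have t2 : `|4 * (dp * (dq * (a * (p * b)))) * g0| <=
    4 * (1 * (1 * (A * e))) * (21 / 10).
  apply: ler_normM g0n; apply: ler_normM; first by rewrite ger0_norm.
  apply: ler_normM ndp1 (ler_normM ndq1 (ler_normM (lexx _) _)).
  by rewrite normrM (ger0_norm p0).
have t3 : 19 / 10 * e ^+ 2 <= g0 * e ^+ 2 by rewrite ler_wpM2r ?sqr_ge0.
have t4 : `|(2 * dp * q * a + dq * (p * b)) * (p * g1)| <=
    (2 * 1 * (1 / 4) * A + 1 * e) * ((A / 4 + e) / 10).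
  apply: ler_normM.
    apply: le_trans (ler_normD _ _) (lerD _ _).
      by apply: ler_normM (lexx _); apply: ler_normM nq; apply: ler_normM ndp1.
    by apply: ler_normM ndq1 _; rewrite normrM (ger0_norm p0).
  rewrite normrM (ger0_norm p0); apply: le_trans (ler_wpM2l p0 g1B) _.
  by rewrite mulrA ler_pM2r.
have t5 : `|q * (p ^+ 2 * g2)| <= 1 / 4 * ((A / 4 + e) ^+ 2 / 10).
  apply: ler_normM nq _; rewrite normrM (ger0_norm (sqr_ge0 p)).
  apply: le_trans (ler_wpM2l (sqr_ge0 p) g2B) _.
  have : (p * L) ^+ 2 <= (A / 4 + e) ^+ 2.
    have Ae0 : 0 <= A / 4 + e by lra.
    by rewrite lerXn2r // nnegrE mulr_ge0.
  by rewrite exprMn; lra.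
have a2 : a ^+ 2 = A ^+ 2 by rewrite /A real_normK ?num_real.
have b2 : b ^+ 2 = B ^+ 2 by rewrite /B real_normK ?num_real.
(* An uneven splitting: the multiple of e ^+ 2 produced here has to stay below
   the main term - 38/10 e ^+ 2, whereas any multiple of A ^+ 2 is harmless. *)
have Ae : A * e <= 2 * A ^+ 2 + e ^+ 2 / 8 by have := sqr_ge0 (A - e / 4); lra.
(* The second derivative of p^2 q g, as
   (p^2 q)'' g + 2 (p^2 q)' g' + p^2 q g''; here 2 - 12 p is 2 dp ^+ 2 - 4 p. *)
pose T := (2 - 12 * p) * q * a ^+ 2 * g0 + 4 * (dp * (dq * (a * (p * b)))) * g0
  - 2 * (g0 * e ^+ 2) + 2 * ((2 * dp * q * a + dq * (p * b)) * (p * g1))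
  + q * (p ^+ 2 * g2).
have TE : T <= 25 * A ^+ 2 - 2 * e ^+ 2.
  move: t1 t2 t4 t5; rewrite !ler_norml /T => /andP[_ t1] /andP[_ t2] /andP[_ t4] /andP[_ t5].
  by have := sqr_ge0 A; have := sqr_ge0 e; lra.
have uA : 2500 * u * A ^+ 2 <= 1 * A ^+ 2 by rewrite ler_wpM2r ?sqr_ge0.
have ue : 0 <= u * e ^+ 2 by rewrite mulr_ge0 ?sqr_ge0.
have uT := ler_wpM2l u0 TE.
apply: (@le_trans _ _ (- 2 * a ^+ 2 + u * T)); last by have := sqr_ge0 A; rewrite a2; lra.
rewrite le_eqVlt; apply/orP; left; apply/eqP.
rewrite /T /e exprMn -b2 (_ : 2 - 12 * p = 2 * dp ^+ 2 - 4 * p); last by rewrite dp2; ring.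
by ring.
Qed.

(** The second derivative of [p (1 - 2 x)] is a multiple of [1 - 2 x] and does
    not vanish with [p], but it comes multiplied by [q], and conversely.  So
    each term contains [q a^2], [a b] or [p b^2] up to a bounded factor. *)
Lemma offdiag_entry_bound : exists c d : R,
  jet2 (fun s => - u * ((P s * (1 - 2 * (x + s * a))) *
    (Q s * (1 - 2 * (y + s * b))) * (denom u (P s) (Q s))^-1)) c d /\
  `|d| <= 17 * u * (q * `|a| * `|a| + `|a| * `|b| + p * `|b| * `|b|).
Proof.
have [k1 [k2 [jk k0B k1B k2B]]] := small_jet_denomV2.
have jl x' a' : jet2 (fun s => logistic (x' + s * a') * (1 - 2 * (x' + s * a')))
    ((1 - 6 * logistic x') * a') (- 6 * (1 - 2 * x') * a' ^+ 2).
  have jd := jet2D (jet2_cst 1) (jet2M (jet2_cst (-2)) (jet2_line x' a')).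
  apply: jet2_ext (jet2M (jet2_logistic x' a') jd) _ _ _.
  - by move=> s; ring.
  - by rewrite !mul0r !addr0 /logistic; ring.
  - by rewrite !mul0r !addr0; ring.
have jx := jl x a; have jy := jl y b.
have j := jet2M (jet2_cst (- u)) (jet2M (jet2M jx jy) jk).
eexists; eexists; split; first exact: j.
rewrite /= -/(P 0) -/(Q 0) P0E Q0E !(mul0r, addr0) -/p -/q.
rewrite P0E Q0E in k0B.
set k0 := (denom u p q)^-1 in k0B *.
pose dp := 1 - 2 * x; pose dq := 1 - 2 * y; rewrite -/dp -/dq.
have ndp1 : `|dp| <= 1 := ndp; have ndq1 : `|dq| <= 1 := ndq.
have A0 := normr_ge0 a; have B0 := normr_ge0 b.
set A := `|a| in A0 *; set B := `|b| in B0 *.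
have np6 : `|1 - 6 * p| <= 1.
  by rewrite ler_norml; apply/andP; split; move: p0 p1; lra.
have nq6 : `|1 - 6 * q| <= 1.
  by rewrite ler_norml; apply/andP; split; move: q0 q1; lra.
have np' : `|p| <= p by rewrite ger0_norm.
have nq' : `|q| <= q by rewrite ger0_norm.
have n6 : `|- 6 : R| <= 6 by rewrite normrN ger0_norm.
have nA : `|a| <= A by []. have nB : `|b| <= B by [].
have nA2 : `|a ^+ 2| <= A ^+ 2 by rewrite normrX.
have nB2 : `|b ^+ 2| <= B ^+ 2 by rewrite normrX.
have s1 : `|p * dp * (- 6 * dq * b ^+ 2) * k0| <= p * 1 * (6 * 1 * B ^+ 2) * 2.
  exact: ler_normM (ler_normM (ler_normM np' ndp1) (ler_normM (ler_normM n6 ndq1) nB2)) k0B.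
have s2 : `|2 * ((1 - 6 * p) * a) * ((1 - 6 * q) * b) * k0| <=
    2 * (1 * A) * (1 * B) * 2.
  exact: ler_normM (ler_normM (ler_normM n2 (ler_normM np6 nA)) (ler_normM nq6 nB)) k0B.
have s3 : `|q * dq * (- 6 * dp * a ^+ 2) * k0| <= q * 1 * (6 * 1 * A ^+ 2) * 2.
  exact: ler_normM (ler_normM (ler_normM nq' ndq1) (ler_normM (ler_normM n6 ndp1) nA2)) k0B.
have s4 : `|p * dp * ((1 - 6 * q) * b) * k1| <= p * 1 * (1 * B) * (2 * L).
  exact: ler_normM (ler_normM (ler_normM np' ndp1) (ler_normM nq6 nB)) k1B.
have s5 : `|q * dq * ((1 - 6 * p) * a) * k1| <= q * 1 * (1 * A) * (2 * L).
  exact: ler_normM (ler_normM (ler_normM nq' ndq1) (ler_normM np6 nA)) k1B.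
have s6 : `|p * dp * (q * dq) * k2| <= p * 1 * (q * 1) * (2 * 2 * L ^+ 2).
  exact: ler_normM (ler_normM (ler_normM np' ndp1) (ler_normM nq' ndq1)) k2B.
pose T := p * dp * (q * dq) * k2
  + 2 * (p * dp * ((1 - 6 * q) * b) * k1 + q * dq * ((1 - 6 * p) * a) * k1)
  + (p * dp * (- 6 * dq * b ^+ 2) * k0
     + 2 * ((1 - 6 * p) * a) * ((1 - 6 * q) * b) * k0
     + q * dq * (- 6 * dp * a ^+ 2) * k0).
have LE : L = A + B by [].
have qA : 0 <= q * A ^+ 2 by rewrite mulr_ge0 ?sqr_ge0.
have pB : 0 <= p * B ^+ 2 by rewrite mulr_ge0 ?sqr_ge0.
have AB0 : 0 <= A * B by rewrite mulr_ge0.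
have pAB := ler_wpM2r AB0 p1; have qAB := ler_wpM2r AB0 q1.
have pqA := ler_wpM2r qA p1; have pqB := ler_wpM2r pB q1.
have pqAB : p * (q * (A * B)) <= 1 / 4 * (1 / 4 * (A * B)).
  exact: ler_pM p0 (mulr_ge0 q0 AB0) p1 qAB.
have TE : `|T| <= 17 * (q * A * A + A * B + p * B * B).
  move: s1 s2 s3 s4 s5 s6; rewrite !ler_norml /T LE.
  move=> /andP[? ?] /andP[? ?] /andP[? ?] /andP[? ?] /andP[? ?] /andP[? ?].
  by apply/andP; split; lra.
rewrite [X in `|X|](_ : _ = - u * T); last by rewrite /T; ring.
rewrite normrM normrN (ger0_norm u0).
by apply: le_trans (ler_wpM2l u0 TE) _; lra.
Qed.

End Line.

End Estimates.

(** * Negativity of the quadratic form *)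

Section Square.
Context {R : realType}.
Implicit Types (u : R) (z v zeta : 'cV[R]_2).

Lemma ord2_ind (T : 'I_2 -> Prop) : T 0 -> T 1 -> forall i, T i.
Proof.
move=> T0 T1 [[|[|//]] lti].
  by rewrite (_ : Ordinal lti = 0) //; exact: val_inj.
by rewrite (_ : Ordinal lti = 1) //; exact: val_inj.
Qed.

Lemma sum2 (F : 'I_2 -> R) : \sum_i F i = F 0 + F 1.
Proof.
rewrite big_ord_recl big_ord1; congr (_ + F _).
exact: val_inj.
Qed.

Lemma quadratic_formE (A : 'M[R]_2) v : quadratic_form A v =
  v 0 0 ^+ 2 * A 0 0 + v 0 0 * v 1 0 * (A 0 1 + A 1 0) + v 1 0 ^+ 2 * A 1 1.
Proof.
rewrite /quadratic_form !mxE sum2 !mxE !sum2 !mxE; ring.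
Qed.

Lemma symmetric2 (A : 'M[R]_2) : A 0 1 = A 1 0 -> A \is symmetricmx.
Proof.
move=> A01; apply/eqP/matrixP; rewrite expr0 scale1r.
by elim/ord2_ind; elim/ord2_ind; rewrite !mxE.
Qed.

Lemma cV2_neq0 v : v != 0 -> v 0 0 != 0 \/ v 1 0 != 0.
Proof.
move=> v0; have [v00|] := eqVneq (v 0 0) 0; last by left.
right; apply: contra_neq v0 => v10; apply/colP.
by elim/ord2_ind; rewrite mxE.
Qed.

(** Put [X = |v0 a|], [Y = |v1 b|], [E = |v0| p |b|] and [F = |v1| q |a|].  The
    diagonal entries contribute at most [- (X^2 + Y^2) - u (E^2 + F^2)], the
    off-diagonal ones at most [34 u (X F + X Y + E Y)].  Since the error has the
    factor [u] and [X^2 + Y^2] does not, a large multiple of [X^2 + Y^2]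
    can be spent to absorb [X F] and [E Y]: [578 = 34^2 / 2] and
    [595 = 578 + 17] is less than half of 2500.  Finally [X], [Y], [E], [F]
    cannot all vanish. *)
Lemma quadratic_form_lt0 u p q a b (A : 'M[R]_2) v :
  0 < p -> 0 < q -> 0 < u -> 2500 * u <= 1 -> A 0 1 = A 1 0 ->
  A 0 0 <= - a ^+ 2 - u * (p * `|b|) ^+ 2 ->
  A 1 1 <= - b ^+ 2 - u * (q * `|a|) ^+ 2 ->
  `|A 0 1| <= 17 * u * (q * `|a| * `|a| + `|a| * `|b| + p * `|b| * `|b|) ->
  a != 0 \/ b != 0 -> v != 0 -> quadratic_form A v < 0.
Proof.
move=> p0 q0 u0 u1 A10 A00 A11 A01 ab /cV2_neq0 v0.
rewrite quadratic_formE -A10.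
set w := v 0 0 in v0 *; set w' := v 1 0 in v0 *.
pose X := `|w| * `|a|; pose Y := `|w'| * `|b|.
pose E := `|w| * (p * `|b|); pose F := `|w'| * (q * `|a|).
have sq (t : R) : t ^+ 2 = `|t| ^+ 2 by rewrite real_normK ?num_real.
have h1 : w ^+ 2 * A 0 0 <= - X ^+ 2 - u * E ^+ 2.
  apply: le_trans (ler_wpM2l (sqr_ge0 w) A00) _.
  by rewrite (sq w) (sq a) /X /E; lra.
have h2 : w' ^+ 2 * A 1 1 <= - Y ^+ 2 - u * F ^+ 2.
  apply: le_trans (ler_wpM2l (sqr_ge0 w') A11) _.
  by rewrite (sq w') (sq b) /Y /F; lra.
have h3 : w * w' * (A 0 1 + A 0 1) <= 34 * (u * (X * F + X * Y + E * Y)).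
  rewrite (_ : w * w' * _ = 2 * (w * w') * A 0 1); last by ring.
  apply: le_trans (ler_norm _) _.
  rewrite normrM [`|2 * _|]normrM normrM (ger0_norm (ler0n R 2)).
  have ww : 0 <= 2 * (`|w| * `|w'|) by rewrite !mulr_ge0.
  apply: le_trans (ler_wpM2l ww A01) _.
  by rewrite /X /Y /E /F; lra.
have pos : 0 < X ^+ 2 + Y ^+ 2 + u * (E ^+ 2 + F ^+ 2).
  have X0 := sqr_ge0 X; have Y0 := sqr_ge0 Y.
  have E0 : 0 <= u * E ^+ 2 by rewrite mulr_ge0 ?sqr_ge0 ?ltW.
  have F0 : 0 <= u * F ^+ 2 by rewrite mulr_ge0 ?sqr_ge0 ?ltW.
  case: v0 => vn0; case: ab => abn0.
  - have : 0 < X ^+ 2 by rewrite exprn_gt0 // mulr_gt0 ?normr_gt0.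
    by lra.
  - have : 0 < u * E ^+ 2 by rewrite mulr_gt0 // exprn_gt0 // !mulr_gt0 ?normr_gt0.
    by lra.
  - have : 0 < u * F ^+ 2 by rewrite mulr_gt0 // exprn_gt0 // !mulr_gt0 ?normr_gt0.
    by lra.
  - have : 0 < Y ^+ 2 by rewrite exprn_gt0 // mulr_gt0 ?normr_gt0.
    by lra.
have XF : 34 * (X * F) <= F ^+ 2 / 2 + 578 * X ^+ 2.
  by have := sqr_ge0 (F - 34 * X); lra.
have EY : 34 * (E * Y) <= E ^+ 2 / 2 + 578 * Y ^+ 2.
  by have := sqr_ge0 (E - 34 * Y); lra.
have XY : 34 * (X * Y) <= 17 * X ^+ 2 + 17 * Y ^+ 2.
  by have := sqr_ge0 (X - Y); lra.
have uXY : u * (595 * (X ^+ 2 + Y ^+ 2)) <= (X ^+ 2 + Y ^+ 2) / 2.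
  have S0 : 0 <= X ^+ 2 + Y ^+ 2 by rewrite addr_ge0 ?sqr_ge0.
  have := ler_wpM2r S0 u1; lra.
have := ler_wpM2l (ltW u0) (lerD (lerD XF XY) EY).
lra.
Qed.

End Square.

(** * The inverse Hessian in closed form *)

Section Mobility.
Context {R : realType}.
Implicit Types (u : R) (z v zeta : 'cV[R]_2).

(** The inverse of the Hessian of [h u] in closed form; being given by a single
    formula, it makes sense on the boundary as well. *)
Definition mobility u z : 'M[R]_2 :=
  let x := z 0 0 in let y := z 1 0 in
  let p := logistic x in let q := logistic y in
  \matrix_(i, j) if i == j
    then logistic (z i 0) * (1 - 2 * u * (p * q)) / denom u p q
    else - u * ((p * (1 - 2 * x)) * (q * (1 - 2 * y)) * (denom u p q)^-1).

Lemma open_open_unit_square : open (@open_unit_square R).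
Proof. by rewrite -interior_unit_square; exact: open_interior. Qed.

Lemma open_unit_squareW z : open_unit_square z -> unit_square z.
Proof. by move=> zU i; have /andP[/ltW -> /ltW ->] := zU i. Qed.

Lemma closed_unit_square : closed (@unit_square R).
Proof.
have -> : @unit_square R = \bigcap_(i in setT)
    ((fun z : 'cV[R]_2 => z i 0) @^-1` `[0, 1]%classic).
  by apply/seteqP; split=> z zS i; have := zS i; rewrite /= in_itv /=; auto.
apply: closed_bigI => i _; apply: closed_comp; last exact: itv_closed.
by move=> z _; exact: coord_continuous.
Qed.

Lemma smooth_h u : smooth_on open_unit_square (h u).
Proof.
apply: (elementary_smooth (n := 1) (g := h u) open_open_unit_square) => //.
have E1 := elementary_cst (n := 1) (@open_unit_square R) 1.
have Ez i := elementary_coord (n := 1) (@open_unit_square R) i.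
have Eln i : elementary (n := 1) (@open_unit_square R) (fun z => ln (z i 0)).
  by apply: elementary_ln => // z /(_ i) /andP[].
have Eoln i : elementary (n := 1) (@open_unit_square R) (fun z => ln (1 - z i 0)).
  apply: elementary_ln; first exact: elementary_sub.
  by move=> z /(_ i) /andP[_]; rewrite subr_gt0.
have Eu := elementary_cst (n := 1) (@open_unit_square R) u.
rewrite /h /=.
by repeat first [assumption | exact: Eln | exact: Eoln | exact: Ez
  | apply: elementary_sub | apply: elementary_add | apply: elementary_mul].
Qed.

Lemma is_derive_onem (t : R) : is_derive t 1 (fun t : R => 1 - t) (-1).
Proof.
apply: (@is_derive_eq _ _ _ _ _ _ _ _
  (is_deriveB (is_derive_cst (1 : R) t 1) (is_derive_id t 1))).
by rewrite sub0r.
Qed.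

Lemma is_derive_entropy (t : R) : 0 < t < 1 ->
  is_derive t 1 (fun t : R => t * ln t + (1 - t) * ln (1 - t))
    (ln t - ln (1 - t)).
Proof.
move=> /andP[t0 t1]; have ot0 : 0 < 1 - t by rewrite subr_gt0.
have dln := is_derive1_ln t0.
have doln := is_derive_comp (f := fun t : R => 1 - t)
  (is_derive1_ln ot0) (is_derive_onem t).
have d := is_deriveD (is_deriveM (is_derive_id t 1) dln)
  (is_deriveM (is_derive_onem t) doln).
apply: (@is_derive_eq _ _ _ _ _ _ _ _ d); rewrite /GRing.scale /=.
by field; rewrite !gt_eqF.
Qed.

Lemma is_derive_logit (t : R) : 0 < t < 1 ->
  is_derive t 1 (fun t : R => ln t - ln (1 - t)) (logistic t)^-1.
Proof.
move=> /andP[t0 t1]; have ot0 : 0 < 1 - t by rewrite subr_gt0.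
have dln := is_derive1_ln t0.
have doln := is_derive_comp (f := fun t : R => 1 - t)
  (is_derive1_ln ot0) (is_derive_onem t).
have d := is_deriveB dln doln.
apply: (@is_derive_eq _ _ _ _ _ _ _ _ d); rewrite /logistic.
by field; rewrite !gt_eqF.
Qed.

Lemma is_derive_logistic (t : R) : is_derive t 1 (@logistic R) (1 - 2 * t).
Proof.
apply: (@is_derive_eq _ _ _ _ _ _ _ _
  (is_deriveM (is_derive_id t 1) (is_derive_onem t))).
by rewrite /GRing.scale /=; ring.
Qed.

Lemma is_derive_onem2 (t : R) : is_derive t 1 (fun t : R => 1 - 2 * t) (-2).
Proof.
apply: (@is_derive_eq _ _ _ _ _ _ _ _
  (is_deriveB (is_derive_cst (1 : R) t 1)
    (is_deriveM (is_derive_cst (2 : R) t 1) (is_derive_id t 1)))).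
by rewrite /GRing.scale /cst /=; ring.
Qed.

Lemma is_derive_coord_comp z v i (F : R -> R) (d : R) :
  is_derive (z i 0) 1 F d -> is_derive z v (fun w => F (w i 0)) (d * v i 0).
Proof. by move=> dF; apply: is_derive_comp dF _; exact: is_derive_coord. Qed.

(** For [i : 'I_2], the other index is [1 - i]. *)
Definition grad_h u z (i : 'I_2) : R :=
  ln (z i 0) - ln (1 - z i 0) + u * ((1 - 2 * z i 0) * logistic (z (1 - i) 0)).

Lemma is_derive_h u z v : open_unit_square z ->
  is_derive z v (h u) (grad_h u z 0 * v 0 0 + grad_h u z 1 * v 1 0).
Proof.
move=> zU.
have dE i := is_derive_coord_comp v (is_derive_entropy (zU i)).
have dl i := is_derive_coord_comp v (is_derive_logistic (z i 0)).
have d := is_deriveD (is_deriveD (dE 0) (dE 1))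
  (is_deriveM (is_derive_cst u z v) (is_deriveM (dl 0) (dl 1))).
have -> : h u = (fun w => (w 0 0 * ln (w 0 0) + (1 - w 0 0) * ln (1 - w 0 0)) +
  (w 1 0 * ln (w 1 0) + (1 - w 1 0) * ln (1 - w 1 0)) +
  u * (logistic (w 0 0) * logistic (w 1 0))).
  by apply/funext => w; rewrite /h /logistic; ring.
apply: (@is_derive_eq _ _ _ _ _ _ _ _ d).
have E10 : 1 - 1 = 0 :> 'I_2 by exact: val_inj.
have E01 : 1 - 0 = 1 :> 'I_2 by exact: val_inj.
rewrite /grad_h E10 E01 /GRing.scale /cst !fctE /=.
by ring.
Qed.

Lemma is_derive_grad_h u z v i : open_unit_square z ->
  is_derive z v (fun w => grad_h u w i)
    (((logistic (z i 0))^-1 - 2 * u * logistic (z (1 - i) 0)) * v i 0 +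
     u * (1 - 2 * z i 0) * (1 - 2 * z (1 - i) 0) * v (1 - i) 0).
Proof.
move=> zU.
have dE := is_derive_coord_comp v (is_derive_logit (zU i)).
have dl := is_derive_coord_comp v (is_derive_logistic (z (1 - i) 0)).
have dl2 := is_derive_coord_comp v (is_derive_onem2 (z i 0)).
have d := is_deriveD dE (is_deriveM (is_derive_cst u z v) (is_deriveM dl2 dl)).
apply: (@is_derive_eq _ _ _ _ _ _ _ _ d).
rewrite /GRing.scale /cst !fctE /=.
by ring.
Qed.

Lemma partial_h u z i : open_unit_square z -> partial i (h u) z = grad_h u z i.
Proof.
move=> zU; rewrite /partial.
have [_ ->] := is_derive_h u (delta_mx i 0) zU.
by elim/ord2_ind: i; rewrite !mxE /= ?mulr1 ?mulr0 ?addr0 ?add0r.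
Qed.

Lemma hessian_h u z i j : open_unit_square z -> hessian (h u) z i j =
  if i == j then (logistic (z i 0))^-1 - 2 * u * logistic (z (1 - i) 0)
  else u * (1 - 2 * z 0 0) * (1 - 2 * z 1 0).
Proof.
move=> zU; rewrite mxE /partial.
rewrite (@near_eq_derive _ _ _ _ (fun w => grad_h u w j)); last first.
  by apply: (open_near_eq open_open_unit_square) zU => w; exact: partial_h.
have [_ ->] := is_derive_grad_h u (delta_mx i 0) j zU.
have E10 : 1 - 1 = 0 :> 'I_2 by exact: val_inj.
have E01 : 1 - 0 = 1 :> 'I_2 by exact: val_inj.
by elim/ord2_ind: i; elim/ord2_ind: j; rewrite ?E10 ?E01 !mxE /=
  ?mulr1 ?mulr0 ?addr0 ?add0r // mulrAC.
Qed.

(** * The closed square: continuity, smoothness, definiteness *)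

Lemma unit_square_logistic z i : unit_square z -> 0 <= logistic (z i 0) <= 1 / 4.
Proof. by move=> zS; rewrite logistic_le logistic_ge0 ?(zS i). Qed.

Lemma unit_square_denom_gt0 u z : 0 <= u <= 1 / 2 -> unit_square z ->
  0 < denom u (logistic (z 0 0)) (logistic (z 1 0)).
Proof. by move=> u01 zS; apply: denom_gt0 => //; exact: unit_square_logistic. Qed.

Lemma mul_hessian_mobility u z : 0 <= u <= 1 / 2 -> open_unit_square z ->
  hessian (h u) z *m mobility u z = 1%:M.
Proof.
move=> u01 zU; have zS := open_unit_squareW zU.
have D0 := lt0r_neq0 (unit_square_denom_gt0 u01 zS).
have p0 := lt0r_neq0 (logistic_gt0 (zU 0)).
have q0 := lt0r_neq0 (logistic_gt0 (zU 1)).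
have Dx := sqr_onem2 (z 0 0); have Dy := sqr_onem2 (z 1 0).
have E10 : 1 - 1 = 0 :> 'I_2 by exact: val_inj.
have E01 : 1 - 0 = 1 :> 'I_2 by exact: val_inj.
have DE : denom u (logistic (z 0 0)) (logistic (z 1 0)) =
  (1 - 2 * u * (logistic (z 0 0) * logistic (z 1 0))) ^+ 2
  - u ^+ 2 * (logistic (z 0 0) * logistic (z 1 0)) *
    ((1 - 2 * z 0 0) * (1 - 2 * z 1 0)) ^+ 2 by rewrite exprMn Dx Dy.
rewrite DE in D0.
apply/matrixP; elim/ord2_ind; elim/ord2_ind;
  rewrite !mxE sum2 !hessian_h // !mxE /= ?E10 ?E01 DE; field;
  by rewrite D0 ?p0 ?q0.
Qed.

Lemma hessian_h_unitmx u z : 0 <= u <= 1 / 2 -> open_unit_square z ->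
  hessian (h u) z \in unitmx.
Proof.
by move=> u01 zU; have [] := mulmx1_unit (mul_hessian_mobility u01 zU).
Qed.

(** On the boundary [p q = 0], so that [denom = 1] and the off-diagonal entries
    vanish. *)
Lemma M_mobility u z : 0 <= u <= 1 / 2 -> unit_square z -> M u z = mobility u z.
Proof.
move=> u01 zS; rewrite /M; case: ifPn => [|zU].
  rewrite inE => zU; have Hu := hessian_h_unitmx u01 zU.
  by rewrite -[LHS]mulmx1 -(mul_hessian_mobility u01 zU) mulKmx.
have pq0 : logistic (z 0 0) * logistic (z 1 0) = 0.
  apply/eqP; apply: contraNT zU; rewrite mulf_eq0 negb_or => /andP[].
  rewrite /logistic !mulf_eq0 !negb_or !subr_eq0 => /andP[x0 x1] /andP[y0 y1].
  rewrite inE; elim/ord2_ind; rewrite !lt_neqAle ?(eq_sym 0) (eq_sym _ 1).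
    by rewrite x0 x1 /=; exact: zS.
  by rewrite y0 y1 /=; exact: zS.
have D1 : denom u (logistic (z 0 0)) (logistic (z 1 0)) = 1.
  by rewrite /denom pq0; ring.
apply/matrixP => i j; rewrite !mxE D1 pq0 mulr0 subr0 mulr1 divr1.
have [->|_] := eqVneq i j; first by rewrite mulr1n.
by rewrite mulr0n invr1 mulr1 mulrACA pq0 mul0r mulr0.
Qed.

Lemma elementary_mobility u (U : set 'cV[R]_2) i j : 0 <= u <= 1 / 2 ->
  U `<=` unit_square -> elementary (n := 1) U (fun z => mobility u z i j).
Proof.
move=> u01 US.
have E c := elementary_cst (n := 1) U c.
have Ez k := elementary_coord (n := 1) U k.
have El k : elementary (n := 1) U (fun z => logistic (z k 0)).
  by apply: elementary_mul => //; exact: elementary_sub.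
have ED : elementary (n := 1) U
    (fun z => (denom u (logistic (z 0 0)) (logistic (z 1 0)))^-1).
  apply: elementary_inv; last first.
    by move=> z /US zS; rewrite lt0r_neq0 // unit_square_denom_gt0.
  rewrite /denom expr2.
  by repeat first [assumption | exact: E | exact: El | exact: Ez
  | apply: elementary_sub | apply: elementary_add | apply: elementary_mul].
rewrite (_ : (fun z => _) = (fun z => if i == j
    then logistic (z i 0) * (1 - 2 * u * (logistic (z 0 0) * logistic (z 1 0)))
      * (denom u (logistic (z 0 0)) (logistic (z 1 0)))^-1
    else - u * ((logistic (z 0 0) * (1 - 2 * z 0 0)) *
      (logistic (z 1 0) * (1 - 2 * z 1 0)) *
      (denom u (logistic (z 0 0)) (logistic (z 1 0)))^-1))); last first.
  by apply/funext => z; rewrite !mxE.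
case: (i == j);
  by repeat first [assumption | exact: E | exact: El | exact: Ez
  | apply: elementary_sub | apply: elementary_add | apply: elementary_mul].
Qed.

Lemma smooth_M u : 0 <= u <= 1 / 2 -> smooth_on open_unit_square (M u).
Proof.
move=> u01; apply: (elementary_mx_smooth (n := 1) (G := mobility u)).
- exact: open_open_unit_square.
- by move=> i j; apply: elementary_mobility => // z; exact: open_unit_squareW.
- by move=> z /open_unit_squareW; exact: M_mobility.
Qed.

Lemma continuous_M u : 0 <= u <= 1 / 2 ->
  {within unit_square, continuous (M u)}.
Proof.
move=> u01; apply: (@subspace_eq_continuous _ _ _ (mobility u)).
  by move=> z; rewrite inE => zS; apply/esym/M_mobility.
apply: continuous_in_subspaceT => z; rewrite inE => zS.
apply: mx_continuous => i j.
exact: (elementary_continuous (elementary_mobility i j u01 (@subset_refl _ _)) zS).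
Qed.

Lemma mobility_symmetric u z : mobility u z 0 1 = mobility u z 1 0.
Proof. by rewrite !mxE. Qed.

(** The off-diagonal term is dominated since
    [|2 u p q v0 v1| <= u p q (v0^2 + v1^2)], which is small compared with
    [p v0^2 + q v1^2]. *)
Lemma positive_definite_M u z : 0 <= u <= 1 / 2 -> open_unit_square z ->
  positive_definite (M u z).
Proof.
move=> u01 zU; have zS := open_unit_squareW zU.
have sM := mobility_symmetric u z.
rewrite M_mobility //; split; first exact: symmetric2.
move=> v /cV2_neq0 v0; rewrite quadratic_formE -sM !mxE /=.
have D0 := unit_square_denom_gt0 u01 zS.
have p0 := logistic_gt0 (zU 0); have q0 := logistic_gt0 (zU 1).
have /andP[_ p1] := unit_square_logistic 0 zS.
have /andP[_ q1] := unit_square_logistic 1 zS.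
set D := denom _ _ _ in D0 *.
set p := logistic _ in p0 p1 D D0 *; set q := logistic _ in q0 q1 D D0 *.
set w := v 0 0 in v0 *; set w' := v 1 0 in v0 *.
have nx := norm_onem2_le1 (zS 0); have ny := norm_onem2_le1 (zS 1).
set dx := 1 - 2 * z 0 0 in nx *; set dy := 1 - 2 * z 1 0 in ny *.
have /andP[u0 u1] := u01.
suff num : 0 < w ^+ 2 * (p * (1 - 2 * u * (p * q)))
    - 2 * u * (p * q) * (w * w' * (dx * dy))
    + w' ^+ 2 * (q * (1 - 2 * u * (p * q))).
  rewrite (_ : _ + _ = (w ^+ 2 * (p * (1 - 2 * u * (p * q)))
    - 2 * u * (p * q) * (w * w' * (dx * dy))
    + w' ^+ 2 * (q * (1 - 2 * u * (p * q)))) / D); last by field; rewrite gt_eqF.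
  exact: divr_gt0.
have cross : `|2 * (w * w' * (dx * dy))| <= w ^+ 2 + w' ^+ 2.
  apply: (@le_trans _ _ (2 * (`|w| * `|w'| * (1 * 1)))).
    by rewrite normrM ger0_norm // ler_pM2l // ler_normM // ?normrM // ler_pM.
  rewrite -(real_normK (num_real w)) -(real_normK (num_real w')).
  by have := sqr_ge0 (`|w| - `|w'|); lra.
have pq0 : 0 < p * q by rewrite mulr_gt0.
have upq0 : 0 <= u * (p * q) by rewrite mulr_ge0 // ltW.
have upq : u * (p * q) <= 1 / 2 * (1 / 4 * (1 / 4)).
  exact: ler_pM u0 (ltW pq0) u1 (ler_pM (ltW p0) (ltW q0) p1 q1).
have h1 : 2 * u * (p * q) * (w * w' * (dx * dy)) <=
    u * (p * q) * (w ^+ 2 + w' ^+ 2).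
  have := ler_wpM2l upq0 (le_trans (ler_norm _) cross); lra.
have h2 : u * (p * q) * w ^+ 2 <= 1 / 8 * (p * w ^+ 2).
  have uq : u * q <= 1 / 2 * (1 / 4) := ler_pM u0 (ltW q0) u1 q1.
  have pw : 0 <= p * w ^+ 2 by rewrite mulr_ge0 ?sqr_ge0 // ltW.
  have := ler_wpM2r pw uq; lra.
have h3 : u * (p * q) * w' ^+ 2 <= 1 / 8 * (q * w' ^+ 2).
  have up : u * p <= 1 / 2 * (1 / 4) := ler_pM u0 (ltW p0) u1 p1.
  have qw : 0 <= q * w' ^+ 2 by rewrite mulr_ge0 ?sqr_ge0 // ltW.
  have := ler_wpM2r qw up; lra.
have pw : 0 <= p * w ^+ 2 by rewrite mulr_ge0 ?sqr_ge0 // ltW.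
have qw : 0 <= q * w' ^+ 2 by rewrite mulr_ge0 ?sqr_ge0 // ltW.
have hp := ler_wpM2r pw upq; have hq := ler_wpM2r qw upq.
have pos : 0 < p * w ^+ 2 + q * w' ^+ 2.
  case: v0 => v0.
    by rewrite ltr_pwDl // mulr_gt0 // exprn_even_gt0.
  by rewrite ltr_wpDl // mulr_gt0 // exprn_even_gt0.
lra.
Qed.

(** * Concavity *)

Lemma denomC (u p q : R) : denom u p q = denom u q p.
Proof. by rewrite /denom; ring. Qed.

(** The second diagonal entry follows from [diag_entry_concave] with the two
    coordinates exchanged. *)
Lemma jet2_M u z zeta : 0 < u -> 2500 * u <= 1 -> open_unit_square z ->
  exists B C : 'M[R]_2, [/\ jet2 (fun s : R => M u (z + s *: zeta)) B C,
    C 0 1 = C 1 0,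
    C 0 0 <= - zeta 0 0 ^+ 2 - u * (logistic (z 0 0) * `|zeta 1 0|) ^+ 2,
    C 1 1 <= - zeta 1 0 ^+ 2 - u * (logistic (z 1 0) * `|zeta 0 0|) ^+ 2 &
    `|C 0 1| <= 17 * u * (logistic (z 1 0) * `|zeta 0 0| * `|zeta 0 0| +
      `|zeta 0 0| * `|zeta 1 0| + logistic (z 0 0) * `|zeta 1 0| * `|zeta 1 0|)].
Proof.
move=> u0 us zU; have zS := open_unit_squareW zU.
have u01 : 0 <= u <= 1 / 2 by apply/andP; split; lra.
have [c0 [d0 [j0 D0]]] :=
  diag_entry_concave (zeta 0 0) (zeta 1 0) (zS 0) (zS 1) (ltW u0) us.
have [c1 [d1 [j1 D1]]] :=
  diag_entry_concave (zeta 1 0) (zeta 0 0) (zS 1) (zS 0) (ltW u0) us.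
have [c2 [d2 [j2 D2]]] :=
  offdiag_entry_bound (zeta 0 0) (zeta 1 0) (zS 0) (zS 1) (ltW u0) us.
pose mk (a b c : R) : 'M[R]_2 :=
  \matrix_(i, j) if i == j then (if i == 0 then a else b) else c.
exists (mk c0 c1 c2), (mk d0 d1 d2); rewrite !mxE /=; split => //.
have near_sq : \forall s \near (0 : R), open_unit_square (z + s *: zeta).
  have cl : (fun s : R => z + s *: zeta) @ 0 --> z.
    rewrite -[X in _ --> X]addr0 -[X in _ + X](scale0r zeta).
    by apply: cvgD; [exact: cvg_cst | apply: cvgZr_tmp; exact: cvg_id].
  exact: cl (open_nbhs_nbhs (conj open_open_unit_square zU)).
apply: (jet2_near_eq (f := fun s => mobility u (z + s *: zeta))).
  apply: filterS near_sq => s /open_unit_squareW sS.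
  by rewrite M_mobility.
apply: jet2_mx; elim/ord2_ind; elim/ord2_ind; rewrite !mxE /=.
- apply: jet2_near_eq j0; apply: filterS near_sq => s /open_unit_squareW sS.
  have /lt0r_neq0 := unit_square_denom_gt0 u01 sS.
  by rewrite !mxE /= => /diag_coefE ->.
- by apply: jet2_ext j2 _ _ _ => // s; rewrite !mxE.
- by apply: jet2_ext j2 _ _ _ => // s; rewrite !mxE.
- apply: jet2_near_eq j1; apply: filterS near_sq => s /open_unit_squareW sS.
  have /lt0r_neq0 := unit_square_denom_gt0 u01 sS.
  rewrite !mxE /= denomC (mulrC (logistic (z 0 0 + _))).
  by move=> /diag_coefE ->.
Qed.

Lemma negative_definite_M u z : 0 < u -> 2500 * u <= 1 -> open_unit_square z ->
  (forall zeta, zeta != 0 ->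
    negative_definite (second_directional_derivative (M u) z zeta)) /\
  (forall zeta,
    negative_semidefinite (second_directional_derivative (M u) z zeta)).
Proof.
move=> u0 us zU.
have neg zeta : zeta != 0 ->
    negative_definite (second_directional_derivative (M u) z zeta).
  move=> zeta0; have [B [C [jM C01 C00 C11 CB]]] := jet2_M zeta u0 us zU.
  rewrite /second_directional_derivative (jet2_derive1n jM).
  split; first exact: symmetric2.
  move=> v; apply: quadratic_form_lt0 C00 C11 CB _ => //.
  - exact: logistic_gt0 (zU 0).
  - exact: logistic_gt0 (zU 1).
  - exact: cV2_neq0.
split=> // zeta; have [->|/neg[sC C0]] := eqVneq zeta 0.
  rewrite /second_directional_derivative.
  rewrite (_ : (fun s : R => _) = cst (M u z)); last first.
    by apply/funext => s; rewrite scaler0 addr0.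
  have -> : derive1n 2 (cst (M u z) : R -> 'M[R]_2) 0 = 0.
    have d0 : derive1 (cst (M u z) : R -> 'M[R]_2) = cst 0.
      by apply/funext => s; rewrite derive1_cst.
    by rewrite derive1nS derive1n1 d0 derive1_cst.
  split; first by apply: symmetric2; rewrite !mxE.
  by move=> v; rewrite /quadratic_form mulmx0 mul0mx mxE.
split=> // v; have [->|/C0/ltW//] := eqVneq v 0.
by rewrite /quadratic_form mulmx0 mxE.
Qed.

(** * Normal vectors *)

(** Moving only the [i]-th coordinate to 0 and to 1 stays in the square and
    tests a normal cone in both directions. *)
Lemma normal_vector_coord z v i : unit_square z -> normal_vectors unit_square z v ->
  0 < z i 0 < 1 -> v i 0 = 0.
Proof.
move=> zS [v1 [v2 [n1 n2 ->]]] zi.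
suff H w : normal_cone unit_square z w -> w i 0 = 0.
  by rewrite !mxE (H v1) // (H v2) // subr0.
move=> nw.
pose z' (t : R) : 'cV[R]_2 := \col_j if j == i then t else z j 0.
have z'S t : 0 <= t <= 1 -> unit_square (z' t).
  by move=> t01 j; rewrite mxE; case: eqP => // _; exact: zS.
have E t : 0 <= t <= 1 -> w i 0 * (t - z i 0) <= 0.
  move=> t01; have := nw _ (z'S _ t01).
  rewrite (bigD1 i) //= !mxE eqxx big1 ?addr0 // => j /negPf ji.
  by rewrite !mxE ji subrr mulr0.
have /andP[zi0 zi1] := zi.
have : w i 0 * (1 - z i 0) <= 0 by apply: E; rewrite ler01 lexx.
have : w i 0 * (0 - z i 0) <= 0 by apply: E; rewrite ler01 lexx.
rewrite sub0r mulrN oppr_le0 pmulr_lge0 // pmulr_lle0 ?subr_gt0 // => w0 w1.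
by apply/eqP; rewrite eq_le w0 w1.
Qed.

(** In each coordinate either the diagonal entry [z_i (1 - z_i)] or the normal
    vector vanishes. *)
Lemma M_normal u z v : boundary unit_square z ->
  normal_vectors unit_square z v -> M u z *m v = 0.
Proof.
rewrite /boundary interior_unit_square => -[].
rewrite -(closure_id _).1 => [|]; last exact: closed_unit_square.
move=> zS zU nv; rewrite /M memNset //.
apply/colP => i; rewrite mul_diag_mx !mxE.
have [zi|] := boolP (0 < z i 0 < 1).
  by rewrite (normal_vector_coord zS nv zi) mulr0.
have /andP[z0 z1] := zS i.
rewrite !lt_neqAle z0 z1 !andbT negb_and !negbK => /orP[/eqP <-|/eqP ->].
  by rewrite !mul0r.
by rewrite subrr mulr0 mul0r.
Qed.

End Mobility.

Theorem mainTheorem9 (R : realType) :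
  \forall eps \near (0 : R)^'+,
  [/\ (* the Hessian of h_eps exists and is invertible on (0,1)^2 *)
      smooth_on open_unit_square (h eps) /\
      (forall z : 'cV[R]_2, open_unit_square z -> hessian (h eps) z \in unitmx),
      (* (i) *)
      {within unit_square, continuous (M eps)} /\
      smooth_on unit_square° (M eps),
      (* (ii) *)
      (forall z : 'cV[R]_2, unit_square° z ->
        M eps z \is symmetricmx /\ positive_definite (M eps z)),
      (* (iii) *)
      (forall z : 'cV[R]_2, unit_square° z ->
        (forall zeta : 'cV[R]_2, zeta != 0 ->
          negative_definite (second_directional_derivative (M eps) z zeta)) /\
        (forall zeta : 'cV[R]_2,
          negative_semidefinite
            (second_directional_derivative (M eps) z zeta))) &
      (* (iv) *)
      (forall z nu : 'cV[R]_2, boundary unit_square z ->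
        normal_vectors unit_square z nu ->
        M eps z *m nu = 0)].
Proof.
near=> u.
have u0 : 0 < u by near: u; exact: nbhs_right_gt.
have us : 2500 * u <= 1.
  have u_lt : u < 1 / 2500.
    by near: u; apply: nbhs_right_lt; lra.
  by lra.
have u01 : 0 <= u <= 1 / 2 by apply/andP; split; lra.
rewrite interior_unit_square; split.
- split; first exact: smooth_h.
  by move=> z zU; exact: hessian_h_unitmx u01 zU.
- by split; [exact: continuous_M u01 | exact: smooth_M u01].
- by move=> z zU; have pM := positive_definite_M u01 zU; split=> //; case: pM.
- by move=> z zU; exact: negative_definite_M u0 us zU.
- by move=> z nu zB; exact: M_normal zB.
Unshelve. all: by end_near. Qed.
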